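(* Let $A\in\mathbb{R}^{n\times n}$ and $b_1,\dots,b_m\in\mathbb{R}^n$ with $m\ge1$. Let $C\subseteq\Delta_m$ be nonempty, compact and convex, let $$S_C:=\{i\in\{1,\dots,m\}\mid p_i>0\text{ for some }p\in C\},$$ let $B_{S_C}$ be the matrix whose columns are the vectors $b_i$ with $i\in S_C$, and let $p^\circ\in\operatorname{ri}C$. For every $T>0$, the following three conditions are equivalent: (a) $C\cap X_T\neq\emptyset$; (b) $\sum_{i\in S_C}W_i(T)\succ O$; (c) $(A,B_{S_C})$ is controllable. Whenever these conditions hold, $p^\circ\in C\cap X_T$.
   Context: $\Delta_m:=\{p\in\mathbb{R}^m\mid p_i\ge0,\ \sum_{i=1}^m p_i=1\}$; $W_i(T):=\int_0^T e^{At}b_ib_i^\top e^{A^\top t}\,dt$; $W(p,T):=\sum_{i=1}^m p_iW_i(T)$; $X_T:=\{p\in\mathbb{R}^m\mid W(p,T)\succ O\}$, where $\succ O$ means positive definite. $\operatorname{ri}C$ is the relative interior of $C$. Controllability of a pair $(A,B)$ is the usual notion for the linear system $\dot x=Ax+Bu$ with state space $\mathbb{R}^n$. *)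

(* Defs.v *)
From HB Require Import structures.
From mathcomp Require Export all_boot all_order all_algebra.
From mathcomp Require Export all_classical all_reals all_analysis.

Set Implicit Arguments.
Unset Strict Implicit.
Unset Printing Implicit Defensive.

Export Order.TTheory GRing.Theory Num.Theory.
Export numFieldNormedType.Exports.

Local Open Scope classical_set_scope.
Local Open Scope ring_scope.

Section Convexity.
Variable R : realType.

Definition simplex (m : nat) : set 'rV[R]_m :=
  [set p | (forall i, 0 <= p ord0 i) /\ \sum_(i < m) p ord0 i = 1].

Definition affine_hull (E : lmodType R) (C : set E) : set E :=
  [set y | exists k (c : 'I_k -> R) (x : 'I_k -> E),
    [/\ forall i, C (x i), \sum_(i < k) c i = 1
      & y = \sum_(i < k) c i *: x i]].

Definition relative_interior (E : normedModType R) (C : set E) : set E :=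
  [set p | C p /\ \forall q \near p, affine_hull C q -> C q].

Definition index_support (m : nat) (C : set 'rV[R]_m) : {set 'I_m} :=
  [set i | `[< exists2 p, C p & 0 < p ord0 i >]]%SET.

End Convexity.

Section LinearSystem.
Variable R : realType.

Definition posdefmx (n : nat) (M : 'M[R]_n) : Prop :=
  M^T = M /\ forall v : 'cV[R]_n, v != 0 -> 0 < (v^T *m M *m v) ord0 ord0.

Definition expmx (n : nat) (A : 'M[R]_n) : 'M[R]_n :=
  limn (series (fun k => k`!%:R^-1 *: A ^+ k)).

Definition integral_mx (k l : nat) (D : set R) (F : R -> 'M[R]_(k, l)) :
    'M[R]_(k, l) :=
  \matrix_(i, j) \int[lebesgue_measure]_(t in D) F t i j.

Definition gramian (n : nat) (A : 'M[R]_n) (b : 'cV[R]_n) (T : R) : 'M[R]_n :=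
  integral_mx `[0, T]
    (fun t => expmx (t *: A) *m b *m b^T *m expmx (t *: A^T)).

Definition weighted_gramian (n m : nat) (A : 'M[R]_n) (b : 'I_m -> 'cV[R]_n)
    (p : 'rV[R]_m) (T : R) : 'M[R]_n :=
  \sum_(i < m) p ord0 i *: gramian A (b i) T.

Definition gramian_posdef_set (n m : nat) (A : 'M[R]_n)
    (b : 'I_m -> 'cV[R]_n) (T : R) : set 'rV[R]_m :=
  [set p | posdefmx (weighted_gramian A b p T)].

Definition selected_columns (n m : nat) (b : 'I_m -> 'cV[R]_n)
    (S : {set 'I_m}) : 'M[R]_(n, #|S|) :=
  \matrix_(i < n, j < #|S|) b (enum_val j) i ord0.

(* x solves x' = A x + B u on [0, tf] in the sense of Caratheodory, written in
   the equivalent integral form; inputs are Lebesgue integrable on [0, tf]. *)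
Definition trajectory (n k : nat) (A : 'M[R]_n) (B : 'M[R]_(n, k)) (tf : R)
    (u : R -> 'cV[R]_k) (x : R -> 'cV[R]_n) : Prop :=
  [/\ forall j, lebesgue_measure.-integrable `[0, tf]
        (fun t => (u t j ord0)%:E),
      {within `[0, tf], continuous x}
    & forall t, 0 <= t <= tf ->
        x t = x 0 + integral_mx `[0, t] (fun s => A *m x s + B *m u s)].

Definition controllable (n k : nat) (A : 'M[R]_n) (B : 'M[R]_(n, k)) : Prop :=
  forall x0 x1 : 'cV[R]_n, exists (tf : R) (u : R -> 'cV[R]_k)
    (x : R -> 'cV[R]_n),
    [/\ 0 < tf, trajectory A B tf u x, x 0 = x0 & x tf = x1].

End LinearSystem.

(* Main.v *)
From mathcomp Require Import ring.
Require Import Defs.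

(** Write [E(t) = expmx (t *: A)] and [quad_i v = v^T W_i(T) v], which is the
    integral over [[0, T]] of [(v^T E(t) b_i)^2] and so is nonnegative.

    Conditions (a) and (b), and the claim on [pint], compare sums of these
    nonnegative numbers. If [W(p, T)] is positive definite and [v] is nonzero,
    some [p_i * quad_i v] is positive; then [i] is in [S] and [quad_i v] is
    positive, which gives (b). Conversely every coordinate of [pint] indexed by
    [S] is positive ([relative_interior_support]), so positivity of the sum over
    [S] survives weighting by [pint], which puts [pint] in [XT] and gives (a).

    For (b) and (c), let [B] have the columns [b_i] with [i] in [S]. The matrix
    in (b) is the Gramian [M(T)] of [(A, B)] ([sum_gramian]).

    If [M(T)] is invertible, an explicit trajectory joins any two states in time
    [T] ([input_gramian_unit_controllable]); that it solves the system comes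
    down to the Lyapunov equation [M' = A M + M A^T + B B^T].

    If [M(T)] is not positive definite, some nonzero [v] has [v^T M(T) v = 0].
    Then [v^T E(t) B] vanishes on an interval, and differentiating at [0] gives
    [v^T A^p B = 0] for all [p] ([input_gramian_kernel]). Along a trajectory
    from [0] each function [v^T A^p x] is then the integral of the next one, and
    a Picard-type estimate forces [v^T x = 0] ([unreachable_direction]); so [v]
    is not reachable, against (c). *)

Set Implicit Arguments.
Unset Strict Implicit.
Unset Printing Implicit Defensive.

Local Open Scope classical_set_scope.
Local Open Scope ring_scope.

(** * Entrywise differentiation of matrix-valued functions *)

Section MatrixDerivative.
Context {R : realType}.

(** Entrywise, so that the calculus of real functions applies and rectangular
    products need no theory of bilinear maps. *)
Definition is_mxderive k l (F : R -> 'M[R]_(k, l)) (t : R)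
    (dF : 'M[R]_(k, l)) : Prop :=
  forall i j, is_derive t 1 (fun s => F s i j) (dF i j).

Lemma is_mxderive_cst k l (M : 'M[R]_(k, l)) t :
  is_mxderive (fun=> M) t 0.
Proof. by move=> i j; rewrite mxE; exact: is_derive_cst. Qed.

Lemma is_mxderiveD k l (F G : R -> 'M[R]_(k, l)) t dF dG :
  is_mxderive F t dF -> is_mxderive G t dG ->
  is_mxderive (fun s => F s + G s) t (dF + dG).
Proof.
move=> hF hG i j; rewrite mxE.
rewrite (_ : (fun s => _) = (fun s => F s i j) + (fun s => G s i j)).
  exact: is_deriveD.
by apply/funext => s; rewrite mxE.
Qed.

Lemma is_mxderiveM k l q (F : R -> 'M[R]_(k, l)) (G : R -> 'M[R]_(l, q))
    t dF dG :
  is_mxderive F t dF -> is_mxderive G t dG ->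
  is_mxderive (fun s => F s *m G s) t (dF *m G t + F t *m dG).
Proof.
move=> hF hG i j.
rewrite (_ : (fun s => _) = \sum_e ((fun s => F s i e) * (fun s => G s e j))).
  rewrite !mxE -big_split /=; apply: is_derive_sum => e.
  apply: is_derive_eq; first exact: is_deriveM.
  by rewrite addrC; congr (_ + _); rewrite /GRing.scale/= mulrC.
by apply/funext => s; rewrite mxE fct_sumE.
Qed.

Lemma is_mxderiveMl k l q (L : 'M[R]_(k, l)) (G : R -> 'M[R]_(l, q)) t dG :
  is_mxderive G t dG -> is_mxderive (fun s => L *m G s) t (L *m dG).
Proof.
by move=> /(is_mxderiveM (is_mxderive_cst L t)); rewrite mul0mx add0r.
Qed.

Lemma is_mxderiveMr k l q (F : R -> 'M[R]_(k, l)) (M : 'M[R]_(l, q)) t dF :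
  is_mxderive F t dF -> is_mxderive (fun s => F s *m M) t (dF *m M).
Proof.
by move=> /is_mxderiveM /(_ (is_mxderive_cst M t)); rewrite mulmx0 addr0.
Qed.

Lemma is_mxderive_tr k l (F : R -> 'M[R]_(k, l)) t dF :
  is_mxderive F t dF -> is_mxderive (fun s => (F s)^T) t dF^T.
Proof.
move=> hF i j; rewrite mxE (_ : (fun s => _) = (fun s => F s j i)) //.
by apply/funext => s; rewrite mxE.
Qed.

Lemma is_mxderive_reflect k l (F : R -> 'M[R]_(k, l)) c t dF :
  is_mxderive F (c - t) dF -> is_mxderive (fun s => F (c - s)) t (- dF).
Proof.
move=> hF i j; rewrite mxE.
have d : is_derive t 1 (fun s : R => c - s) (- 1).
  rewrite -[- 1]sub0r.
  exact: is_deriveB (is_derive_cst c t 1) (is_derive_id t 1).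
by have := @is_derive1_comp _ _ _ t _ _ (hF i j) d; rewrite mulrN1.
Qed.

Lemma is_mxderive_continuous k l (F : R -> 'M[R]_(k, l)) t dF i j :
  is_mxderive F t dF -> {for t, continuous (fun s => F s i j)}.
Proof.
move=> /(_ i j)[h _].
exact/differentiable_continuous/derivable1_diffP.
Qed.

Lemma cvg_mx_coord (I : Type) (H : set_system I) {FH : Filter H} k l
    (F : I -> 'M[R]_(k, l)) (M : 'M[R]_(k, l)) :
  (forall i j, F x i j @[x --> H] --> M i j) -> F x @[x --> H] --> M.
Proof.
move=> h; apply/cvg_ballP => e e0.
have : \forall s \near H, forall i j, ball (M i j) e (F s i j).
  apply: (@filter_forall _ _ (fun i s => forall j, ball (M i j) e (F s i j))).
  move=> i.
  apply: (@filter_forall _ _ (fun j s => ball (M i j) e (F s i j))) => j.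
  by have /cvg_ballP/(_ e e0) := h i j.
by apply: filterS => s Fs; split.
Qed.

End MatrixDerivative.

(** * The matrix exponential and its differential equation *)

Section MatrixExponential.
Context {R : realType} {n : nat}.
Implicit Types A : 'M[R]_n.

(** The entrywise l^1 norm: it is submultiplicative also for rectangular
    products, so it controls both [A ^+ p] and [M *m A ^+ p]. *)
Definition mx_abs_sum k l (M : 'M[R]_(k, l)) : R := \sum_i \sum_j `|M i j|.

Lemma mx_abs_sum_ge0 k l (M : 'M[R]_(k, l)) : 0 <= mx_abs_sum M.
Proof. by apply: sumr_ge0 => i _; apply: sumr_ge0. Qed.

Lemma le_mx_abs_sum k l (M : 'M[R]_(k, l)) i j : `|M i j| <= mx_abs_sum M.
Proof.
rewrite /mx_abs_sum (bigD1 i)//= (bigD1 j)//= -addrA lerDl.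
by rewrite addr_ge0// ?sumr_ge0// => p _; rewrite sumr_ge0.
Qed.

Lemma mx_abs_sumM k l q (M : 'M[R]_(k, l)) (N : 'M[R]_(l, q)) :
  mx_abs_sum (M *m N) <= mx_abs_sum M * mx_abs_sum N.
Proof.
rewrite /mx_abs_sum mulr_suml; apply: ler_sum => i _.
apply: (@le_trans _ _ (\sum_j \sum_e `|M i e| * `|N e j|)).
  apply: ler_sum => j _; rewrite mxE; apply: le_trans (ler_norm_sum _ _ _) _.
  by apply: ler_sum => e _; rewrite normrM.
rewrite exchange_big mulr_suml /=; apply: ler_sum => e _.
rewrite -mulr_sumr ler_wpM2l//.
by rewrite [leRHS](bigD1 e)//= lerDl sumr_ge0// => p _; rewrite sumr_ge0.
Qed.

Lemma mx_abs_sumMX k (M : 'M[R]_(k, n)) A p :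
  mx_abs_sum (M *m A ^+ p) <= mx_abs_sum M * mx_abs_sum A ^+ p.
Proof.
elim: p => [|p IH]; first by rewrite !expr0 mulmx1 mulr1.
rewrite !exprSr (mulmxA M (A ^+ p) A); apply: le_trans (mx_abs_sumM _ _) _.
by rewrite mulrA ler_wpM2r// mx_abs_sum_ge0.
Qed.

Lemma expmxZ (t : R) A k : (t *: A) ^+ k = t ^+ k *: A ^+ k.
Proof.
elim: k => [|k IH]; first by rewrite !expr0 scale1r.
rewrite !exprSr IH; change (t ^+ k *: A ^+ k *m (t *: A) =
  (t ^+ k * t) *: (A ^+ k *m A)).
by rewrite -scalemxAl -scalemxAr scalerA.
Qed.

Definition expmx_coef A i j : R^nat := fun k => (A ^+ k) i j / k`!%:R.

(** Each entry of [expmx (t *: A)] is a real power series in [t]; it converges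
    everywhere because it is dominated by the exponential series of
    [mx_abs_sum A * `|t|]. *)
Lemma is_cvg_expmx_coef A i j t : cvgn (pseries (expmx_coef A i j) t).
Proof.
apply: normed_cvg.
pose a := mx_abs_sum A; pose c := mx_abs_sum (1%:M : 'M[R]_n).
apply: (@series_le_cvg _ _ (c *: exp_coeff (a * `|t|))).
- by move=> k; exact: normr_ge0.
- move=> k; rewrite fctE mulr_ge0 ?mx_abs_sum_ge0//.
  by rewrite exp_coeff_ge0// mulr_ge0// mx_abs_sum_ge0.
- move=> k; rewrite fctE /expmx_coef /exp_coeff /= normrM normrM normrX.
  rewrite exprMn /GRing.scale/=.
  rewrite normfV normr_nat mulrAC !mulrA ler_wpM2r ?invr_ge0//.
  rewrite ler_wpM2r ?exprn_ge0//; apply: le_trans (le_mx_abs_sum _ i j) _.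
  by have := mx_abs_sumMX 1%:M A k; rewrite mul1mx.
- by apply: is_cvg_seriesZ; exact: is_cvg_series_exp_coeff.
Qed.

Lemma expmxE A t i j :
  expmx (t *: A) i j = limn (pseries (expmx_coef A i j) t).
Proof.
pose L : 'M[R]_n := \matrix_(i, j) limn (pseries (expmx_coef A i j) t).
suff /cvg_lim h : series (fun k => k`!%:R^-1 *: (t *: A) ^+ k) @ \oo --> L.
  by rewrite /expmx h// mxE.
apply: cvg_mx_coord => p q; rewrite mxE.
suff <- : pseries (expmx_coef A p q) t =
    (fun N => series (fun k => k`!%:R^-1 *: (t *: A) ^+ k) N p q).
  exact: is_cvg_expmx_coef.
apply/funext => N; rewrite /pseries /series /= summxE.
apply: eq_bigr => k _; rewrite expmxZ !mxE /expmx_coef.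
by rewrite mulrAC [RHS]mulrC; congr (_ * _); rewrite mulrC.
Qed.

Lemma cvg_pseries_sum (a : 'I_n -> R) (c : 'I_n -> R^nat) (L : 'I_n -> R) t :
  (forall e, pseries (c e) t @ \oo --> L e) ->
  pseries (fun k => \sum_e a e * c e k) t @ \oo --> \sum_e a e * L e.
Proof.
move=> h; rewrite (_ : pseries _ t = fun N => \sum_e a e * pseries (c e) t N).
  apply: cvg_big => [|e _]; first exact: add_continuous.
  by apply: cvgMl_tmp; exact: h.
apply/funext => N; rewrite /pseries /series /=.
under [RHS]eq_bigr do rewrite mulr_sumr.
rewrite exchange_big /=; apply: eq_bigr => k _.
by rewrite mulr_suml; apply: eq_bigr => e _; rewrite mulrA.
Qed.

(** The recursion [A ^+ k.+1 = A *m A ^+ k] at the level of coefficients: formal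
    differentiation of the series of row [i] is multiplication by [A]. *)
Lemma expmx_coef_diffs A i j :
  pseries_diffs (expmx_coef A i j) =
  fun k => \sum_e A i e * expmx_coef A e j k.
Proof.
apply/funext => k; rewrite /pseries_diffs /expmx_coef factS natrM invfM.
rewrite mulrCA mulVKf ?pnatr_eq0// exprS.
rewrite (_ : (A * A ^+ k) i j = \sum_e A i e * (A ^+ k) e j) ?mulr_suml.
  by apply: eq_bigr => e _; rewrite mulrA.
by rewrite [LHS]mxE.
Qed.

(** Termwise differentiation of the power series needs the series and its first
    two formal derivatives to converge at a point of larger modulus; formal
    derivatives are combinations of the original series. *)
Lemma is_mxderive_expmx A t :
  is_mxderive (fun s => expmx (s *: A)) t (A *m expmx (t *: A)).
Proof.
move=> i j; rewrite (_ : (fun s => _) =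
    fun s => limn (pseries (expmx_coef A i j) s)); last first.
  by apply/funext => s; rewrite expmxE.
have diffs_cvg s p q : pseries (pseries_diffs (expmx_coef A p q)) s @ \oo -->
    \sum_e A p e * limn (pseries (expmx_coef A e q) s).
  by rewrite expmx_coef_diffs; apply: cvg_pseries_sum => e;
    exact: is_cvg_expmx_coef.
have -> : (A *m expmx (t *: A)) i j =
    limn (pseries (pseries_diffs (expmx_coef A i j)) t).
  rewrite mxE; have /cvg_lim -> // := diffs_cvg t i j.
  by apply: eq_bigr => e _; rewrite expmxE.
(* Any radius beyond |t| would do. *)
apply: (@pseries_snd_diffs _ _ (`|t| + 1)).
- exact: is_cvg_expmx_coef.
- by apply: cvgP; exact: diffs_cvg.
- suff -> : pseries_diffs (pseries_diffs (expmx_coef A i j)) = fun k =>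
      \sum_e A i e * pseries_diffs (expmx_coef A e j) k.
    by apply: cvgP; apply: cvg_pseries_sum => e; exact: diffs_cvg.
  rewrite expmx_coef_diffs; apply/funext => k; rewrite /pseries_diffs mulr_sumr.
  by apply: eq_bigr => e _; rewrite mulrCA.
- by rewrite [ltRHS]ger0_norm ?addr_ge0// ltrDl.
Qed.

Lemma expmx0 : expmx (0 : 'M[R]_n) = 1%:M.
Proof.
rewrite -(scale0r (0 : 'M[R]_n)); apply/matrixP => i j; rewrite expmxE.
apply/cvg_lim => //; apply: cvg_near_cst; near=> N.
rewrite /pseries /series /=.
have N0 : (0 < N)%N by near: N; exact: nbhs_infty_gt.
rewrite big_ltn// big_nat big1 => [|[//|k] _]; last first.
  by rewrite [X in _ * X]expr0n mulr0.
by rewrite addr0 expr0 mulr1 /expmx_coef expr0 fact0 divr1.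
Unshelve. all: by end_near. Qed.

Lemma expmx_tr A t : (expmx (t *: A))^T = expmx (t *: A^T).
Proof.
apply/matrixP => i j; rewrite mxE !expmxE; congr (limn (pseries _ t)).
apply/funext => k; rewrite /expmx_coef; congr (_ / _).
suff -> : A^T ^+ k = (A ^+ k)^T by rewrite mxE.
elim: k => [|k IH]; first by rewrite !expr0 [RHS]trmx1.
by rewrite exprSr exprS IH; symmetry; exact: trmx_mul.
Qed.

End MatrixExponential.

(** * Antiderivatives and integrals of matrix-valued functions *)

Section Antiderivative.
Context {R : realType}.
Local Notation mu := (@lebesgue_measure R).

Lemma continuous_segment_integrable (f : R -> R) (a b : R) :
  (forall s : R, a <= s <= b -> {for s, continuous f}) ->
  mu.-integrable `[a, b] (EFin \o f).
Proof.
move=> cf; apply: continuous_compact_integrable; first exact: segment_compact.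
apply: continuous_in_subspaceT => s; rewrite inE/= in_itv/=; exact: cf.
Qed.

(** Anchoring the integral at [-1] makes the antiderivative differentiable at
    [0] as well, so that no one-sided derivative occurs on [[0, +oo[]. *)
Lemma antiderivative_exists (f : R -> R) : continuous f ->
  exists F : R -> R, forall t : R, -1 < t -> is_derive t 1 F (f t).
Proof.
move=> cf; exists (fun t => \int[mu]_(s in `[-1, t]) f s) => t t1.
have [||dF <-] := @continuous_FTC1_closed _ f (-1) t (t + 1) _ _ t1 (cf t).
- by rewrite ltrDl.
- by apply: continuous_segment_integrable => s _; exact: cf.
- by rewrite derive1E; exact/derivableP.
Qed.

Lemma Rintegral_derive (f F : R -> R) (t : R) : 0 <= t ->
  (forall s : R, 0 <= s <= t -> is_derive s 1 F (f s)) ->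
  (forall s : R, 0 <= s <= t -> {for s, continuous f}) ->
  \int[mu]_(s in `[0, t]) f s = F t - F 0.
Proof.
rewrite le_eqVlt => /predU1P[<- _ _|t0 dF cf].
  by rewrite set_itv1 Rintegral_set1 subrr.
have cF (s : R) : 0 <= s <= t -> {for s, continuous F}.
  by move=> /dF[h _]; exact/differentiable_continuous/derivable1_diffP.
rewrite /Rintegral (@continuous_FTC2 _ f F)//.
- by apply: continuous_in_subspaceT => s; rewrite inE/= in_itv/=; exact: cf.
- split.
  + move=> s; rewrite in_itv/= => /andP[s0 st].
    by have [|] := dF s; rewrite ?(ltW s0) ?ltW.
  + by apply: cvg_at_right_filter; apply: cF; rewrite lexx ltW.
  + by apply: cvg_at_left_filter; apply: cF; rewrite lexx ltW.
- move=> s; rewrite in_itv/= => /andP[s0 st].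
  rewrite derive1E; have [|_ ->//] := dF s.
  by rewrite (ltW s0) ltW.
Qed.

Lemma is_derive_locally_cst (f : R -> R) (a b c d t : R) :
  is_derive t 1 f d -> (forall s, a < s -> s < b -> f s = c) ->
  a < t -> t < b -> d = 0.
Proof.
move=> [_ <-] fc at_ tb; transitivity ('D_1 (cst c) t).
  apply: near_eq_derive; near=> s; apply: fc.
    by near: s; exact: lt_nbhsr.
  by near: s; exact: lt_nbhsl.
exact: derive_cst.
Unshelve. all: by end_near. Qed.

(** An antiderivative of [f ^+ 2] is nondecreasing with equal values at [0] and
    [T], hence constant in between, so its derivative vanishes there. *)
Lemma Rintegral_sqr_eq0 (f : R -> R) (T t : R) : continuous f ->
  \int[mu]_(s in `[0, T]) (f s ^+ 2) = 0 -> 0 < t < T -> f t = 0.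
Proof.
move=> cf int0 /andP[t0 tT].
have cf2 : continuous (fun s => f s ^+ 2).
  by move=> s; rewrite /continuous_at; apply: cvgM; exact: cf.
have [F dF] := antiderivative_exists cf2.
have gtN1 (s : R) : 0 <= s -> -1 < s by apply: lt_le_trans; rewrite ltrN10.
have dF0 (s : R) : 0 <= s -> is_derive s 1 F (f s ^+ 2) by move=> /gtN1/dF.
have mono (a c : R) : 0 <= a -> a < c -> F a <= F c.
  move=> a0 ac; have [||z _ zE] := @MVT _ F (fun s => f s ^+ 2) a c ac.
  - move=> z; rewrite in_itv/= => /andP[az _]; apply: dF0.
    by rewrite ltW// (le_lt_trans a0).
  - apply: continuous_in_subspaceT => s; rewrite inE/= in_itv/= => /andP[as_ _].
    have [h _] := dF0 s (le_trans a0 as_).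
    exact/differentiable_continuous/derivable1_diffP.
  - by rewrite -subr_ge0 zE mulr_ge0 ?sqr_ge0// subr_ge0 ltW.
have FT : F T = F 0.
  have T0 := ltW (lt_trans t0 tT).
  suff /eqP : F T - F 0 = 0 by rewrite subr_eq0 => /eqP.
  rewrite -[RHS]int0; symmetry; apply: Rintegral_derive => // [s /andP[+ _]|s _].
    exact: dF0.
  exact: cf2.
have Fcst (s : R) : 0 < s -> s < T -> F s = F 0.
  move=> s0 sT; apply/eqP; rewrite eq_le (mono 0 s)// andbT -FT.
  exact: (mono s T (ltW s0)).
apply/eqP; rewrite -sqrf_eq0; apply/eqP.
apply: (is_derive_locally_cst (dF0 t (ltW t0)) _ t0 tT) => s s0 sT.
exact: Fcst.
Qed.

End Antiderivative.

Section MatrixIntegral.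
Context {R : realType}.
Local Notation mu := (@lebesgue_measure R).

Definition mx_integrable k l (D : set R) (F : R -> 'M[R]_(k, l)) : Prop :=
  forall i j, mu.-integrable D (fun t => (F t i j)%:E).

Lemma Rintegral_sum d (X : measurableType d) (nu : {measure set X -> \bar R})
    (I : Type) (r : seq I) (D : set X) (f : I -> X -> R) :
  measurable D -> (forall i, nu.-integrable D (EFin \o f i)) ->
  nu.-integrable D (fun t => (\sum_(i <- r) f i t)%:E) /\
  \int[nu]_(t in D) (\sum_(i <- r) f i t) =
    \sum_(i <- r) \int[nu]_(t in D) f i t.
Proof.
move=> mD intf; elim: r => [|i r [IHi IHe]].
  under eq_fun do rewrite big_nil; under eq_Rintegral do rewrite big_nil.
  by rewrite Rintegral_cst// mul0r big_nil; split=> //; exact: integrable0.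
under eq_fun do rewrite big_cons; under eq_Rintegral do rewrite big_cons.
rewrite big_cons RintegralD// IHe; split => //.
exact: (integrableD mD (intf i) IHi).
Qed.

Lemma integral_mxMl k l q (D : set R) (L : 'M[R]_(k, l))
    (F : R -> 'M[R]_(l, q)) : measurable D -> mx_integrable D F ->
  mx_integrable D (fun t => L *m F t) /\
  integral_mx D (fun t => L *m F t) = L *m integral_mx D F.
Proof.
move=> mD intF.
have intLF i j e : mu.-integrable D (EFin \o (fun t => L i e * F t e j)).
  exact: (@integrableZl _ _ _ mu D mD (L i e) _ (intF e j)).
have S i j := @Rintegral_sum _ _ mu _ (index_enum 'I_l) D _ mD (intLF i j).
split=> [i j|].
  by under eq_fun do rewrite mxE; have [] := S i j.
apply/matrixP => i j; rewrite !mxE; under eq_Rintegral do rewrite mxE.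
have [_ ->] := S i j; apply: eq_bigr => e _; rewrite mxE RintegralZl//.
exact: intF.
Qed.

Lemma integral_mx_tr k l (D : set R) (F : R -> 'M[R]_(k, l)) :
  (integral_mx D F)^T = integral_mx D (fun t => (F t)^T).
Proof.
by apply/matrixP => i j; rewrite !mxE; apply: eq_Rintegral => t _; rewrite mxE.
Qed.

Lemma integral_mxMr k l q (D : set R) (F : R -> 'M[R]_(k, l))
    (M : 'M[R]_(l, q)) : measurable D -> mx_integrable D F ->
  integral_mx D (fun t => F t *m M) = integral_mx D F *m M.
Proof.
move=> mD intF; apply: trmx_inj; rewrite trmx_mul !integral_mx_tr.
have intFT : mx_integrable D (fun t => (F t)^T).
  by move=> i j; under eq_fun do rewrite mxE; exact: intF.
have [_ <-] := integral_mxMl M^T mD intFT.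
by congr integral_mx; apply/funext => t; rewrite trmx_mul.
Qed.

Lemma mx_integrableD k l (D : set R) (F G : R -> 'M[R]_(k, l)) :
  measurable D -> mx_integrable D F -> mx_integrable D G ->
  mx_integrable D (fun t => F t + G t).
Proof.
move=> mD intF intG i j; rewrite (_ : (fun t => _) =
    (fun t => (F t i j)%:E) \+ (fun t => (G t i j)%:E))%E.
  exact: (@integrableD _ _ _ mu D mD _ _ (intF i j) (intG i j)).
by apply/funext => t; rewrite mxE EFinD.
Qed.

Lemma integral_mxD k l (D : set R) (F G : R -> 'M[R]_(k, l)) :
  measurable D -> mx_integrable D F -> mx_integrable D G ->
  integral_mx D (fun t => F t + G t) = integral_mx D F + integral_mx D G.
Proof.
move=> mD intF intG; apply/matrixP => i j; rewrite !mxE.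
rewrite -RintegralD//; [|exact: intF|exact: intG].
by apply: eq_Rintegral => t _; rewrite mxE.
Qed.

Lemma integral_mx_derive k l (F G : R -> 'M[R]_(k, l)) (t : R) : 0 <= t ->
  (forall s : R, 0 <= s <= t -> is_mxderive G s (F s)) ->
  (forall s : R, 0 <= s <= t ->
    forall i j, {for s, continuous (fun r => F r i j)}) ->
  integral_mx `[0, t] F = G t - G 0.
Proof.
move=> t0 dG cF; apply/matrixP => i j; rewrite !mxE.
apply: (@Rintegral_derive _ (fun s => F s i j) (fun s => G s i j)) => //.
- by move=> s /dG; exact.
- by move=> s /cF; exact.
Qed.

Lemma mx_antiderivative_exists k l (F : R -> 'M[R]_(k, l)) :
  (forall i j, continuous (fun s => F s i j)) ->
  exists G : R -> 'M[R]_(k, l), forall t : R, -1 < t -> is_mxderive G t (F t).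
Proof.
move=> cF.
have /choice[g gP] (ij : 'I_k * 'I_l) := antiderivative_exists (cF ij.1 ij.2).
exists (fun t => \matrix_(i, j) g (i, j) t) => t t1 i j.
by under eq_fun do rewrite mxE; exact: gP (i, j) t t1.
Qed.

End MatrixIntegral.

(** * The Gramian of a general input matrix *)

Section InputGramian.
Context {R : realType} {n : nat}.
Local Notation mu := (@lebesgue_measure R).
Variable A : 'M[R]_n.

Definition gramian_integrand k (B : 'M[R]_(n, k)) (t : R) : 'M[R]_n :=
  expmx (t *: A) *m B *m B^T *m expmx (t *: A^T).

(** Convertible to [gramian A B T] when [B] is a single column. *)
Definition input_gramian k (B : 'M[R]_(n, k)) (T : R) : 'M[R]_n :=
  integral_mx `[0, T] (gramian_integrand B).

Lemma mx_derivable_integrable k l (F dF : R -> 'M[R]_(k, l)) (a c : R) :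
  (forall t, is_mxderive F t (dF t)) -> mx_integrable `[a, c] F.
Proof.
move=> dFP i j; apply: (@continuous_segment_integrable _ (fun s => F s i j)).
by move=> s _; exact: is_mxderive_continuous (dFP s).
Qed.

Lemma is_mxderive_expmx_tr t :
  is_mxderive (fun s => expmx (s *: A^T)) t (expmx (t *: A^T) *m A^T).
Proof.
rewrite -expmx_tr -trmx_mul.
rewrite (_ : (fun s => _) = fun s => (expmx (s *: A))^T).
  exact/is_mxderive_tr/is_mxderive_expmx.
by apply/funext => s; rewrite expmx_tr.
Qed.

(** The integrand [P] solves the Lyapunov equation [P' = A P + P A^T]; this
    stands in for the group law of the exponential. *)
Lemma is_mxderive_gramian_integrand k (B : 'M[R]_(n, k)) t :
  is_mxderive (gramian_integrand B) t
    (A *m gramian_integrand B t + gramian_integrand B t *m A^T).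
Proof.
rewrite /gramian_integrand !mulmxA -[X in _ + X]mulmxA.
apply: is_mxderiveM; last exact: is_mxderive_expmx_tr.
by do 2 apply: is_mxderiveMr; exact: is_mxderive_expmx.
Qed.

Lemma integrable_gramian_integrand k (B : 'M[R]_(n, k)) (T : R) :
  mx_integrable `[0, T] (gramian_integrand B).
Proof.
exact: mx_derivable_integrable (@is_mxderive_gramian_integrand _ B).
Qed.

Lemma trmx_input_gramian k (B : 'M[R]_(n, k)) T :
  (input_gramian B T)^T = input_gramian B T.
Proof.
rewrite integral_mx_tr; congr integral_mx; apply/funext => t.
by rewrite /gramian_integrand -expmx_tr !trmx_mul !trmxK !mulmxA.
Qed.

(** The integrand factors as [(E(t) B) (E(t) B)^T] with [E(t) = expmx (t *: A)],
    so the quadratic form of the Gramian is a sum of integrals of squares. *)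
Lemma input_gramian_quad k (B : 'M[R]_(n, k)) T (v : 'cV[R]_n) :
  (v^T *m input_gramian B T *m v) 0 0 =
  \sum_j \int[mu]_(t in `[0, T]) ((v^T *m expmx (t *: A) *m B) 0 j ^+ 2).
Proof.
have mD : measurable (`[0, T] : set R) by [].
have quadE t : (v^T *m gramian_integrand B t *m v) 0 0 =
    \sum_j ((v^T *m expmx (t *: A) *m B) 0 j ^+ 2).
  set w := v^T *m expmx (t *: A) *m B.
  have -> : v^T *m gramian_integrand B t *m v = w *m w^T.
    by rewrite /gramian_integrand /w -expmx_tr !trmx_mul trmxK !mulmxA.
  by rewrite mxE; apply: eq_bigr => j _; rewrite [w^T _ _]mxE expr2.
have [intvP <-] := integral_mxMl v^T mD (@integrable_gramian_integrand _ B T).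
rewrite -integral_mxMr// mxE; under eq_Rintegral do rewrite quadE.
have dw t : is_mxderive (fun s => v^T *m expmx (s *: A) *m B) t
    (v^T *m (A *m expmx (t *: A)) *m B).
  exact/is_mxderiveMr/is_mxderiveMl/is_mxderive_expmx.
have intw j : mu.-integrable `[0, T]
    (EFin \o (fun t => (v^T *m expmx (t *: A) *m B) 0 j ^+ 2)).
  apply: continuous_segment_integrable => s _.
  by apply: cvgM; exact: is_mxderive_continuous (dw s).
by have [_ ->] := @Rintegral_sum _ _ _ mu _ (index_enum 'I_k) `[0, T] _ mD intw.
Qed.

Lemma input_gramian_quad_ge0 k (B : 'M[R]_(n, k)) T (v : 'cV[R]_n) :
  0 <= (v^T *m input_gramian B T *m v) 0 0.
Proof.
rewrite input_gramian_quad; apply: sumr_ge0 => j _.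
by apply: Rintegral_ge0 => t _; exact: sqr_ge0.
Qed.

Lemma input_gramian_quad_eq0 k (B : 'M[R]_(n, k)) T (v : 'cV[R]_n) t :
  (v^T *m input_gramian B T *m v) 0 0 = 0 -> 0 < t < T ->
  v^T *m expmx (t *: A) *m B = 0.
Proof.
rewrite input_gramian_quad => /eqP; rewrite psumr_eq0 => [/allP h tT|j _].
  apply/rowP => j; rewrite [RHS]mxE.
  apply: (@Rintegral_sqr_eq0 _
    (fun s => (v^T *m expmx (s *: A) *m B) 0 j) T) => // [s|].
    apply: (@is_mxderive_continuous _ _ _
      (fun s => v^T *m expmx (s *: A) *m B) _
      (v^T *m (A *m expmx (s *: A)) *m B)).
    exact/is_mxderiveMr/is_mxderiveMl/is_mxderive_expmx.
  by apply/eqP; apply: h; rewrite mem_index_enum.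
by apply: Rintegral_ge0 => s _; exact: sqr_ge0.
Qed.

(** A null vector [v] of the Gramian annihilates [E(t) B] on [0 < t < T];
    differentiating [p] times gives [v^T A^p E(t) B = 0] there, and letting [t]
    tend to [0] leaves [v^T A^p B = 0]. *)
Lemma input_gramian_kernel k (B : 'M[R]_(n, k)) T (v : 'cV[R]_n) p : 0 < T ->
  (v^T *m input_gramian B T *m v) 0 0 = 0 -> v^T *m A ^+ p *m B = 0.
Proof.
move=> T0 vMv; pose f q s := v^T *m A ^+ q *m expmx (s *: A) *m B.
have df q s : is_mxderive (f q) s (f q.+1 s).
  rewrite /f exprSr (mulmxA v^T (A ^+ q) A) -[X in X *m B]mulmxA.
  exact/is_mxderiveMr/is_mxderiveMl/is_mxderive_expmx.
have f0 q s : 0 < s -> s < T -> f q s = 0.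
  elim: q s => [|q IH] s s0 sT.
    rewrite /f expr0 mulmx1; apply: (input_gramian_quad_eq0 vMv).
    by rewrite s0.
  apply/rowP => j; rewrite [RHS]mxE.
  apply: (is_derive_locally_cst (c := 0) (df q s 0 j) _ s0 sT) => r r0 rT.
  by rewrite IH// mxE.
(* The derivative f p.+1 also vanishes inside, so the mean value theorem on
   [0, T / 2] carries the vanishing of f p over to the endpoint 0. *)
suff : f p 0 = 0 by rewrite /f scale0r expmx0 mulmx1.
apply/rowP => j; have T20 : 0 < T / 2 by rewrite divr_gt0.
have T2T : T / 2 < T by rewrite ltr_pdivrMr// ltr_pMr// ltr1n.
have [|s _||c] := @MVT _ (fun s => f p s 0 j) (fun s => f p.+1 s 0 j) 0 (T / 2).
- exact: T20.
- exact: (df p s 0 j).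
- by apply: continuous_subspaceT => s; exact: is_mxderive_continuous (df p s).
rewrite in_itv/= => /andP[c0 cT]; rewrite (f0 p _ T20 T2T).
rewrite (f0 p.+1 _ c0 (lt_trans cT T2T)) !mxE mul0r.
by rewrite sub0r => /eqP; rewrite oppr_eq0 => /eqP.
Qed.

(** Since [B B^T] is the sum of the [b_i b_i^T] over the columns of [B], the
    matrix of condition (b) is the Gramian of the pair in condition (c). *)
Lemma sum_gramian m (b : 'I_m -> 'cV[R]_n) (S : {set 'I_m}) T :
  \sum_(i in S) gramian A (b i) T = input_gramian (selected_columns b S) T.
Proof.
have mD : measurable (`[0, T] : set R) by [].
have integrandE t : gramian_integrand (selected_columns b S) t =
    \sum_(j < #|S|) gramian_integrand (b (enum_val j)) t.
  rewrite /gramian_integrand -mulmx_suml; congr (_ *m _).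
  under eq_bigr do rewrite -mulmxA.
  rewrite -mulmx_sumr -mulmxA; congr (_ *m _).
  apply/matrixP => p q; rewrite summxE mxE; apply: eq_bigr => j _.
  by rewrite !mxE big_ord1 !mxE.
rewrite big_enum_val; apply/matrixP => p q; rewrite summxE mxE.
under [RHS]eq_Rintegral do rewrite integrandE summxE.
have int (j : 'I_#|S|) :=
  @integrable_gramian_integrand _ (b (enum_val j)) T p q.
have [_ ->] := @Rintegral_sum _ _ _ mu _ (index_enum 'I_#|S|) `[0, T] _ mD int.
by apply: eq_bigr => j _; rewrite mxE.
Qed.

End InputGramian.

(** * Directions unreachable from the origin *)

Section Unreachable.
Context {R : realType} {n k : nat}.
Local Notation mu := (@lebesgue_measure R).
Variables (A : 'M[R]_n) (B : 'M[R]_(n, k)).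

Lemma le_mx_norm p q (M : 'M[R]_(p, q)) i j : `|M i j| <= `|M|.
Proof.
rewrite [leRHS]mx_normrE.
exact: (@le_bigmax _ _ _ 0 (fun ij : 'I_p * 'I_q => `|M ij.1 ij.2|) (i, j)).
Qed.

Lemma mx_abs_sum_le_norm p q (M : 'M[R]_(p, q)) :
  mx_abs_sum M <= (p * q)%:R * `|M|.
Proof.
apply: (@le_trans _ _ (\sum_(i < p) \sum_(j < q) `|M|)).
  by apply: ler_sum => i _; apply: ler_sum => j _; exact: le_mx_norm.
by rewrite !sumr_const !card_ord -mulrnA mulr_natl mulnC.
Qed.

Lemma continuous_mx_abs_sum_bounded p q (x : R -> 'M[R]_(p, q)) (T : R) :
  {within `[0, T], continuous x} ->
  exists2 K : R, 0 <= K & forall t, 0 <= t <= T -> mx_abs_sum (x t) <= K.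
Proof.
move=> cx; have /compact_bounded[K [_ hK]] :=
  continuous_compact cx (@segment_compact _ 0 T).
have K0 : 0 <= Num.max 0 (K + 1) by rewrite le_max lexx.
exists ((p * q)%:R * Num.max 0 (K + 1)) => [|t tT]; first exact: mulr_ge0.
apply: le_trans (mx_abs_sum_le_norm _) _; rewrite ler_wpM2l//.
apply: (hK (Num.max 0 (K + 1))); first by rewrite lt_max ltrDl ltr01 orbT.
by exists t => //=; rewrite in_itv.
Qed.

Lemma Rintegral_monomial (c t : R) N : 0 <= t ->
  \int[mu]_(s in `[0, t]) (c * (s ^+ N / N`!%:R)) = c * (t ^+ N.+1 / N.+1`!%:R).
Proof.
move=> t0; pose F : R -> R := (c / N.+1`!%:R) *: (id : R -> R) ^+ N.+1.
have FE s : F s = c * (s ^+ N.+1 / N.+1`!%:R).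
  by rewrite /F !fctE /GRing.scale/= mulrAC mulrA.
have dF (s : R) : is_derive s 1 F (c * (s ^+ N / N`!%:R)).
  apply: is_derive_eq.
  rewrite /GRing.scale/= mulr1 factS natrM.
  by field; rewrite [1 + _]addrC natr1 !pnatr_eq0 -lt0n fact_gt0.
rewrite (@Rintegral_derive _ _ F) ?FE ?expr0n ?mul0r ?mulr0 ?subr0 //.
move=> s _; apply: cvgMl_tmp; apply: cvgMr_tmp; exact: exprn_continuous.
Qed.

(** Put [y_p = v^T A^p x]. The input term drops out of the integral equation, so
    [y_p(t)] is the integral of [y_{p+1}] over [[0, t]]. Iterating [N] times
    from a bound on [x] gives [|y_0(t)| <= V (a t)^N / N!] for every [N], hence
    [y_0 = 0]. As the inputs are merely integrable, [x] need not be
    differentiable, and the argument uses only the integral equation. *)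
Lemma unreachable_direction (tf : R) u x (v : 'cV[R]_n) :
  (forall p, v^T *m A ^+ p *m B = 0) ->
  trajectory A B tf u x -> x 0 = 0 -> 0 <= tf -> v^T *m x tf = 0.
Proof.
move=> vAB [intu cx xE] x0 tf0.
have [K K0 xK] := continuous_mx_abs_sum_bounded cx.
have mD (t : R) : measurable (`[0, t] : set R) by [].
have intx t : 0 <= t <= tf -> mx_integrable `[0, t] x.
  move=> /andP[t0 ttf] i j.
  apply: (@continuous_compact_integrable _ (fun s => x s i j)).
    exact: segment_compact.
  apply: (@continuous_subspaceW _ _ _ `[0, tf]).
    by apply: subset_itvl; rewrite bnd_simp.
  by move=> s; apply: cvg_comp (cx s) (@coord_continuous R n 1 i j (x s)).
have intu' t : 0 <= t <= tf -> mx_integrable `[0, t] u.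
  move=> /andP[t0 ttf] i j; rewrite ord1; apply: integrableS (intu i) => //.
  by apply: subset_itvl; rewrite bnd_simp.
pose y p t := v^T *m A ^+ p *m x t.
have inty p t : 0 <= t <= tf -> mx_integrable `[0, t] (y p).
  by move=> /intx/(integral_mxMl (v^T *m A ^+ p) (mD t))[].
have yE p t : 0 <= t <= tf -> y p t = integral_mx `[0, t] (y p.+1).
  move=> tT; rewrite /y xE// x0 add0r.
  have [intAx _] := integral_mxMl A (mD t) (intx t tT).
  have [intBu _] := integral_mxMl B (mD t) (intu' t tT).
  have intF : mx_integrable `[0, t] (fun s => A *m x s + B *m u s).
    exact: mx_integrableD.
  have [_ <-] := integral_mxMl (v^T *m A ^+ p) (mD t) intF.
  congr integral_mx; apply/funext => s.
  rewrite mulmxDr !mulmxA vAB mul0mx addr0.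
  by rewrite /y exprSr (mulmxA v^T (A ^+ p) A).
pose a := mx_abs_sum A; pose V := mx_abs_sum v^T * K.
have y_le N : forall p t, 0 <= t <= tf ->
    `|y p t 0 0| <= V * a ^+ (p + N) * (t ^+ N / N`!%:R).
  elim: N => [|N IH] p t tT.
    rewrite addn0 expr0 fact0 divr1 mulr1.
    apply: le_trans (le_mx_abs_sum _ _ _) _.
    apply: le_trans (mx_abs_sumM _ _) _; rewrite mulrAC.
    by rewrite ler_pM ?mx_abs_sum_ge0 ?xK// mx_abs_sumMX.
  rewrite yE// mxE.
  have inty0 : mu.-integrable `[0, t] (EFin \o (fun s => y p.+1 s 0 0)).
    exact: inty.
  apply: le_trans (@le_normr_Rintegral _ _ _ mu _ _ (mD t) inty0) _.
  case/andP: (tT) => t0 ttf.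
  rewrite addnS -addSn -Rintegral_monomial//; apply: le_Rintegral => //.
  - exact: integrable_norm.
  - apply: continuous_segment_integrable => s _.
    by apply: cvgMl_tmp; apply: cvgMr_tmp; exact: exprn_continuous.
  - move=> s /=; rewrite in_itv/= => /andP[s0 st].
    by apply: IH; rewrite s0 (le_trans st).
apply/matrixP => i j; rewrite !ord1 [RHS]mxE; apply/eqP; apply: contraT.
rewrite -normr_gt0 => y0.
have lim0 : V * exp_coeff (a * tf) N @[N --> \oo] --> V * 0.
  by apply: cvgMl_tmp; exact: cvg_exp_coeff.
have /cvgr_lt/(_ _) := lim0; rewrite mulr0 => /(_ _ y0)[N _ /(_ N (leqnn N))] /=.
have := y_le N 0%N tf; rewrite tf0 lexx => /(_ isT).
rewrite /y expr0 mulmx1 add0n /exp_coeff/= exprMn !mulrA => h1 h2.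
by have := le_lt_trans h1 h2; rewrite ltxx.
Qed.

End Unreachable.

(** * Positive definite matrices *)

Section PositiveDefinite.
Context {R : realType} {n : nat}.
Implicit Types M : 'M[R]_n.

Lemma posdefmx_unit M : posdefmx M -> M \in unitmx.
Proof.
move=> [MT M0]; rewrite -row_free_unit -kermx_eq0.
apply: contraT => /rowV0Pn[w /sub_kermxP wM w0].
have := M0 w^T; rewrite trmx_eq0 => /(_ w0).
by rewrite trmxK wM mul0mx mxE ltxx.
Qed.

Lemma trmx_mulmx_eq0 (v : 'cV[R]_n) : v^T *m v = 0 -> v = 0.
Proof.
move=> /matrixP/(_ 0 0); rewrite !mxE => /eqP.
under eq_bigr do rewrite mxE -expr2.
rewrite psumr_eq0 => [/allP h|i _]; last exact: sqr_ge0.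
apply/colP => i; rewrite mxE; apply/eqP; rewrite -sqrf_eq0.
by apply: h; rewrite mem_index_enum.
Qed.

Lemma mulmx_sum_quad I (r : seq I) (P : pred I) (F : I -> 'M[R]_n)
    (v : 'cV[R]_n) :
  (v^T *m (\sum_(i <- r | P i) F i) *m v) 0 0 =
  \sum_(i <- r | P i) (v^T *m F i *m v) 0 0.
Proof. by rewrite mulmx_sumr mulmx_suml summxE. Qed.

End PositiveDefinite.

(** * Controllability and the Gramian *)

Section Controllability.
Context {R : realType} {n k : nat}.
Variables (A : 'M[R]_n) (B : 'M[R]_(n, k)).

(** Integrating [P' = A P + P A^T] from [P(0) = B B^T]. *)
Lemma gramian_lyapunov (t : R) : 0 <= t ->
  gramian_integrand A B t =
  A *m input_gramian A B t + input_gramian A B t *m A^T + B *m B^T.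
Proof.
move=> t0; have mD : measurable (`[0, t] : set R) by [].
have intP := @integrable_gramian_integrand R n A k B t.
have dP := @is_mxderive_gramian_integrand R n A k B.
have [intAP AP] := integral_mxMl A mD intP.
have intPA : mx_integrable `[0, t] (fun s => gramian_integrand A B s *m A^T).
  by apply: mx_derivable_integrable => s; apply: is_mxderiveMr; exact: dP.
have P0 : gramian_integrand A B 0 = B *m B^T.
  by rewrite /gramian_integrand !scale0r !expmx0 mul1mx mulmx1.
apply/eqP; rewrite -P0 -subr_eq eq_sym /input_gramian -AP -integral_mxMr//.
rewrite -integral_mxD//; apply/eqP.
apply: integral_mx_derive => // s _ i j.
apply: is_mxderive_continuous; apply: is_mxderiveD.
  by apply: is_mxderiveMl; exact: dP.
by apply: is_mxderiveMr; exact: dP.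
Qed.

(** The minimum-energy input [u(s) = B^T E(T - s)^T eta] steers [x0] to [x1] in
    time [T] when [eta] solves [M(T) eta = x1 - E(T) x0], [M(s)] being the
    Gramian on [[0, s]]. After the change of variable [s := t - s] in the
    variation of constants formula, the state is
    [x(t) = E(t) x0 + M(t) E(T - t)^T eta]: this closed form contains no
    convolution, has the right endpoints by inspection, and solves
    [x' = A x + B u] by the product rule and [gramian_lyapunov]. *)
Lemma input_gramian_unit_controllable (T : R) : 0 < T ->
  input_gramian A B T \in unitmx -> controllable A B.
Proof.
move=> T0 MT x0 x1.
have dP := @is_mxderive_gramian_integrand R n A k B.
have [G dG] := mx_antiderivative_exists
  (fun i j s => is_mxderive_continuous (dP s) (i := i) (j := j)).
(* The Gramian on [0, s], extended to s > -1 to be differentiable at 0. *)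
pose M s := G s - G 0.
have dM s : -1 < s -> is_mxderive M s (gramian_integrand A B s).
  move=> /dG dGs; rewrite -[gramian_integrand _ _ _]addr0.
  exact: is_mxderiveD dGs (is_mxderive_cst _ _).
have gtN1 (s : R) : 0 <= s -> -1 < s by apply: lt_le_trans; rewrite ltrN10.
have ME s : 0 <= s -> M s = input_gramian A B s.
  move=> s0; rewrite /input_gramian (@integral_mx_derive _ _ _ _ G)//.
    by move=> r /andP[r0 _]; apply: dG; exact: gtN1.
  by move=> r _ i j; exact: is_mxderive_continuous (dP r).
pose eta := invmx (input_gramian A B T) *m (x1 - expmx (T *: A) *m x0).
pose N s := expmx ((T - s) *: A^T).
have dN s : is_mxderive N s (- (A^T *m N s)).
  apply: (@is_mxderive_reflect _ _ _ (fun s => expmx (s *: A^T))).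
  exact: is_mxderive_expmx.
pose u s := B^T *m N s *m eta.
pose x s := expmx (s *: A) *m x0 + M s *m N s *m eta.
have du s : is_mxderive u s (B^T *m (- (A^T *m N s)) *m eta).
  by apply: is_mxderiveMr; apply: is_mxderiveMl; exact: dN.
have dx s : 0 <= s -> is_mxderive x s (A *m x s + B *m u s).
  move=> s0.
  have -> : A *m x s + B *m u s = A *m expmx (s *: A) *m x0 +
      (gramian_integrand A B s *m N s + M s *m (- (A^T *m N s))) *m eta.
    rewrite (gramian_lyapunov s0) -ME//.
    rewrite /x /u; move: (M s) (N s) (eta) => Ms Ns w.
    rewrite mulmxN !mulmxDl !mulmxDr !mulmxA mulNmx.
    by rewrite -!addrA; do 2 congr (_ + _); rewrite addrC subrK.
  apply: is_mxderiveD; first exact/is_mxderiveMr/is_mxderive_expmx.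
  by apply: is_mxderiveMr; apply: is_mxderiveM => //; apply: dM; exact: gtN1.
exists T, u, x; split => //.
- split.
  + move=> j; apply: (@continuous_segment_integrable _ (fun s => u s j ord0)).
    by move=> s _; exact: is_mxderive_continuous (du s).
  + apply: continuous_in_subspaceT => s; rewrite inE/= in_itv/= => /andP[s0 _].
    by apply: cvg_mx_coord => i j; exact: is_mxderive_continuous (dx s s0).
  + move=> t /andP[t0 tT]; rewrite (@integral_mx_derive _ _ _ _ x)//.
    * by rewrite addrC subrK.
    * by move=> s /andP[s0 _]; exact: dx.
    * move=> s /andP[s0 _] i j; apply: is_mxderive_continuous.
      apply: is_mxderiveD; first by apply: is_mxderiveMl; exact: dx.
      by apply: is_mxderiveMl; exact: du.
- by rewrite /x /M subrr !mul0mx addr0 scale0r expmx0 mul1mx.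
- rewrite /x /N subrr scale0r expmx0 mulmx1 ME ?ltW// /eta mulKVmx//.
  by rewrite addrC subrK.
Qed.

(** Were [v] a nonzero null vector of the Gramian, every trajectory from [0]
    would stay orthogonal to [v], yet controllability reaches [v] itself. *)
Lemma controllable_posdef_input_gramian (T : R) : 0 < T ->
  controllable A B -> posdefmx (input_gramian A B T).
Proof.
move=> T0 ctrl; split=> [|v v0]; first exact: trmx_input_gramian.
rewrite lt_neqAle input_gramian_quad_ge0 andbT eq_sym.
apply: contra v0 => /eqP vMv; apply/eqP.
have [tf [u [x [tf0 xtraj x0 xtf]]]] := ctrl 0 v.
apply: trmx_mulmx_eq0; rewrite -[in X in _ *m X]xtf.
apply: unreachable_direction xtraj x0 (ltW tf0) => p.
exact: input_gramian_kernel vMv.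
Qed.

End Controllability.

(** * Relative interiors in the simplex *)

Section RelativeInterior.
Context {R : realType}.

Lemma affine_hull_line (E : lmodType R) (C : set E) (p r : E) (e : R) :
  C p -> C r -> affine_hull C (p + e *: (p - r)).
Proof.
move=> Cp Cr.
exists 2%N, (fun i => if i == 0 then 1 + e else - e),
  (fun i => if i == 0 then p else r); split.
- by move=> i; case: ifP.
- by rewrite big_ord_recl big_ord1/= addrK.
- rewrite big_ord_recl big_ord1/= scalerDl scale1r scalerBr scaleNr.
  by rewrite addrA.
Qed.

(** A segment of [C] ending at a relative interior point can be prolonged a
    little beyond it without leaving [C]. *)
Lemma relative_interior_extend (E : normedModType R) (C : set E) (p r : E) :
  relative_interior C p -> C r ->
  exists2 e : R, 0 < e & C (p + e *: (p - r)).
Proof.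
move=> [Cp /= riCp] Cr.
have lim : (p + e *: (p - r)) @[e --> (0 : R)^'+] --> p.
  apply: cvg_at_right_filter.
  rewrite -[X in _ --> X]addr0 -[X in _ --> _ + X](scale0r (p - r)).
  by apply: cvgD; [exact: cvg_cst|apply: cvgZr_tmp; exact: cvg_id].
have near_C := lim _ riCp.
near (0 : R)^'+ => e; exists e => //.
have : affine_hull C (p + e *: (p - r)) by exact: affine_hull_line.
by near: e.
Unshelve. all: by end_near. Qed.

(** Prolonging from a point [r] with [r_i > 0] past [p] would make the [i]-th
    coordinate negative if [p_i] were [0]. *)
Lemma relative_interior_support m (C : set 'rV[R]_m) (p : 'rV[R]_m) i :
  (forall q, C q -> 0 <= q ord0 i) -> relative_interior C p ->
  i \in index_support C -> 0 < p ord0 i.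
Proof.
move=> C0 riCp; rewrite inE => /asboolP[r Cr ri0].
have [e e0 /C0] := relative_interior_extend riCp Cr.
rewrite !mxE mulrBr addrA -{1}[p ord0 i]mul1r -mulrDl subr_ge0.
move=> /(lt_le_trans (mulr_gt0 e0 ri0)); rewrite pmulr_rgt0//.
by rewrite addr_gt0.
Qed.

End RelativeInterior.

(** * The equivalence *)

Theorem lemma3 (R : realType) (n m : nat) (hm : (0 < m)%N)
    (A : 'M[R]_n) (b : 'I_m -> 'cV[R]_n)
    (C : set 'rV[R]_m) (C_simplex : C `<=` @simplex R m)
    (C_nonempty : C !=set0) (C_compact : compact C) (C_convex : convex_set C)
    (pint : 'rV[R]_m) (pint_ri : relative_interior C pint)
    (T : R) (hT : 0 < T) :
  let XT := gramian_posdef_set A b T in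
  let S := index_support C in
  let cond_a := C `&` XT !=set0 in
  let cond_b := posdefmx (\sum_(i in S) gramian A (b i) T) in
  let cond_c := controllable A (selected_columns b S) in
  [/\ cond_a <-> cond_b, cond_b <-> cond_c
    & cond_a -> (C `&` XT) pint].
Proof.
move=> XT S cond_a cond_b cond_c.
have C0 q i : C q -> 0 <= q ord0 i by move=> /C_simplex[].
pose quad i (v : 'cV[R]_n) := (v^T *m gramian A (b i) T *m v) 0 0.
have quad_ge0 i v : 0 <= quad i v by exact: input_gramian_quad_ge0.
have sym_gramian i : (gramian A (b i) T)^T = gramian A (b i) T.
  exact: trmx_input_gramian.
have wquadE p v : (v^T *m weighted_gramian A b p T *m v) 0 0 =
    \sum_i p ord0 i * quad i v.
  rewrite mulmx_sum_quad; apply: eq_bigr => i _.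
  by rewrite -scalemxAr -scalemxAl mxE.
(* For nonnegative weights the sum of the p_i quad_i is positive exactly when one
   term is, and then i is in S. *)
have a_b : cond_a -> cond_b.
  move=> [p [Cp [_ posp]]]; split=> [|v v0].
    by rewrite linear_sum; apply: eq_bigr => i _; exact: sym_gramian.
  rewrite mulmx_sum_quad lt_neqAle sumr_ge0 ?andbT => [|i _]; last exact: quad_ge0.
  rewrite eq_sym psumr_neq0 => [|i _]; last exact: quad_ge0.
  have := posp v v0; rewrite wquadE => /lt0r_neq0/eqP/psumr_neq0P[i _|i].
    by rewrite mulr_ge0// C0.
  move=> /andP[_ piqi]; apply/hasP; exists i; first exact: mem_index_enum.
  have pi0 : 0 < p ord0 i.
    by rewrite lt_neqAle C0// andbT; apply: contraTneq piqi => <-;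
      rewrite mul0r ltxx.
  move: piqi; rewrite pmulr_rgt0// => ->; rewrite andbT inE.
  by apply/asboolP; exists p.
(* Conversely the coordinates of pint in S are all positive, so a positive term
   of the sum over S stays positive after weighting. *)
have b_pint : cond_b -> (C `&` XT) pint.
  move=> [_ posS]; split; first by case: pint_ri.
  split=> [|v v0].
    rewrite linear_sum; apply: eq_bigr => i _.
    by rewrite linearZ/= sym_gramian.
  rewrite wquadE; have Cpint : C pint by case: pint_ri.
  rewrite lt_neqAle sumr_ge0 ?andbT => [|i _]; last by rewrite mulr_ge0// C0.
  rewrite eq_sym psumr_neq0 => [|i _]; last by rewrite mulr_ge0// C0.
  have := posS v v0; rewrite mulmx_sum_quad => /lt0r_neq0/eqP/psumr_neq0P[i _|i].
    exact: quad_ge0.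
  move=> /andP[iS qi0]; apply/hasP; exists i; first exact: mem_index_enum.
  rewrite mulr_gt0//; apply: relative_interior_support pint_ri iS => q.
  exact: C0.
split.
- by split=> [//|/b_pint]; exists pint.
- rewrite /cond_b sum_gramian; split.
    by move=> /posdefmx_unit; exact: input_gramian_unit_controllable.
  exact: controllable_posdef_input_gramian.
- by move=> /a_b/b_pint.
Qed.
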